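(* Let $(X,\|\cdot\|)$ be a real or complex Banach space over $\mathbb{F}$ ($\mathbb{F}=\mathbb{R}$ or $\mathbb{F}=\mathbb{C}$) with a Schauder basis $\{e_k\}_{k\in\mathbb{N}}$ such that $\|e_k\|=1$ for all $k\in\mathbb{N}$. Let $(w_k)_{k\in\mathbb{N}}$ be an arbitrary weight sequence in $\mathbb{F}$ such that \[ 1\le |w_k|\le |w_{k+1}|,\quad k\in\mathbb{N},\qquad\text{and}\qquad \sum_{k=1}^\infty |w_k|^{-1}<\infty . \] Then the weighted backward shift \[ D(A)\ni x=\sum_{k=1}^\infty x_ke_k\ \mapsto\ Ax:=\sum_{k=1}^\infty w_kx_{k+1}e_k , \] with the domain \[ D(A):=\left\{x=\sum_{k=1}^\infty x_ke_k\in X\ \middle|\ \sum_{k=1}^\infty w_kx_{k+1}e_k\in X\right\}, \] is a chaotic unbounded linear operator in $X$.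
   Context: $\mathbb{N}=\{1,2,\dots\}$, $\mathbb{Z}_+=\{0,1,2,\dots\}$. A Schauder basis of a Banach space $(X,\|\cdot\|)$ over $\mathbb{F}$ is a countably infinite set $\{e_k\}_{k\in\mathbb{N}}\subseteq X$ such that for every $x\in X$ there is a unique sequence $(x_k)_{k\in\mathbb{N}}$ in $\mathbb{F}$ with $x=\sum_{k=1}^\infty x_ke_k$ (convergence of partial sums in norm); the $x_k$ are the coordinates of $x$. The condition $\sum_{k=1}^\infty w_kx_{k+1}e_k\in X$ means that this series converges in $X$. Let $A:X\supseteq D(A)\to X$ be a (bounded or unbounded) linear operator, with powers $A^n$ defined on their natural (iterated) domains $D(A^n)$, $A^0:=I$ the identity operator. Put $C^\infty(A):=\bigcap_{n=0}^\infty D(A^n)$. A nonzero vector $x\in C^\infty(A)$ is called hypercyclic for $A$ if its orbit $\{A^nx\}_{n\in\mathbb{Z}_+}$ is dense in $X$; $A$ is hypercyclic if it possesses a hypercyclic vector. A vector $x$ is a periodic point of $A$ if there is $N\in\mathbb{N}$ with $x\in D(A^N)$ and $A^Nx=x$. $A$ is chaotic if it is hypercyclic and its set of periodic points is dense in $X$. *)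

(* Defs.v *)
From HB Require Import structures.
From mathcomp Require Import all_boot all_order all_algebra.
From mathcomp Require Import complex.
From mathcomp Require Import all_classical all_reals all_analysis.

Set Implicit Arguments.
Unset Strict Implicit.
Unset Printing Implicit Defensive.

Import Order.TTheory GRing.Theory Num.Theory.
Import numFieldNormedType.Exports.

Local Open Scope classical_set_scope.
Local Open Scope ring_scope.

(* All sequences are indexed from 0: [e k], [w k], [basis_coord e x k] stand for
   e_{k+1}, w_{k+1}, x_{k+1} of the usual 1-based indexing. *)

Inductive scalar_kind := RealScalars | ComplexScalars.

Definition scalar_field (R : realType) (s : scalar_kind) : numFieldType :=
  match s with
  | RealScalars => R
  | ComplexScalars => R[i]
  end.

Section PartialOperators.
Variables (K : numFieldType) (X : normedModType K).

(* A possibly partially defined operator X ⊇ D(A) -> X; the values of [act]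
   outside [dom] are irrelevant. *)
Record operator := Operator { dom : set X ; act : X -> X }.

Definition linear_operator (A : operator) : Prop :=
  dom A 0 /\
  forall (a : K) (x y : X), dom A x -> dom A y ->
    dom A (a *: x + y) /\ act A (a *: x + y) = a *: act A x + act A y.

Definition bounded_operator (A : operator) : Prop :=
  exists M : K, forall x, dom A x -> `|act A x| <= M * `|x|.

Definition id_operator : operator := Operator setT id.

Definition comp_operator (A B : operator) : operator :=
  Operator [set x | dom B x /\ dom A (act B x)] (act A \o act B).

Definition power (A : operator) (n : nat) : operator :=
  iter n (comp_operator A) id_operator.

Definition Cinfty (A : operator) : set X := \bigcap_n dom (power A n).

Definition hypercyclic_vector (A : operator) (x : X) : Prop :=
  [/\ x != 0, Cinfty A x & dense (range (fun n => act (power A n) x))].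

Definition hypercyclic (A : operator) : Prop :=
  exists x, hypercyclic_vector A x.

Definition periodic_point (A : operator) (x : X) : Prop :=
  exists N : nat,
    [/\ (0 < N)%N, dom (power A N) x & act (power A N) x = x].

Definition chaotic (A : operator) : Prop :=
  hypercyclic A /\ dense [set x | periodic_point A x].

Definition expansion (e : nat -> X) (c : nat -> K) (x : X) : Prop :=
  series (fun k => c k *: e k) @ \oo --> x.

Definition schauder_basis (e : nat -> X) : Prop :=
  injective e /\ forall x, exists! c : nat -> K, expansion e c x.

(* Chosen by [get]; determined by [x] when [e] is a Schauder basis. *)
Definition basis_coord (e : nat -> X) (x : X) : nat -> K :=
  get [set c : nat -> K | expansion e c x].

Definition shift_series (e : nat -> X) (w : nat -> K) (x : X) : nat -> X :=
  series (fun k => (w k * basis_coord e x k.+1) *: e k).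

Definition backward_shift (e : nat -> X) (w : nat -> K) : operator :=
  Operator [set x | cvgn (shift_series e w x)]
           (fun x => limn (shift_series e w x)).

End PartialOperators.

(* Main.v *)
Require Import Defs.
From HB Require Import structures.
From mathcomp Require Import all_boot all_order all_algebra.
From mathcomp Require Import complex.
From mathcomp Require Import all_classical all_reals all_analysis.

Import Order.TTheory GRing.Theory Num.Theory.
Import numFieldNormedType.Exports.

Local Open Scope classical_set_scope.
Local Open Scope ring_scope.

(** The operator acts on coordinates as c |-> (k |-> w k * c k.+1), and its n-th
iterate multiplies c (k + n) by the weight product wprod k n. Inverting these
products plants prescribed vectors along one orbit. Cut the indices into blocks
[n j, n j.+1) and let s j be finite sequences of scalars; put in block j the
entries (s j)_k divided by wprod k (n j). After n j shifts, block j has moved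
to the front and shows exactly s j ([block_sequence]). The later blocks
contribute little: an entry now at position k is still divided by the weights on
a stretch w r, ..., w k.-1 at least as long as a gap. Its last factor is w k.-1, its
next-to-last factor absorbs the size of the entries of the next sequence as soon
as the gap is long, and the remaining factors are at least 1 in norm. So the
entry is at most `|w k.-1|^-1 ([block_tail]). By summability of the inverse
weights and completeness of the space, every iterate has an expansion, and the
iterate of order n j is within the tail sum of `|w k.-1|^-1, over k >= n j.+1 -
n j, of the finite combination of the e k with coefficients s j ([block_orbit]).

Both halves of chaos are instances. If all s j are the same sequence and all
gaps are equal to N, then the coordinates are invariant under N shifts, and the
vector is a periodic point close to that finite combination ([periodic_dense]).
If s runs infinitely often through every finite sequence over a countable dense
set of scalars, and the gaps tend to infinity, the orbit comes arbitrarily close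
to every such combination, hence is dense ([backward_shift_hypercyclic]).

Linearity follows from the uniqueness of expansions. The operator is unbounded
because it sends the unit vector e k.+1 to w k *: e k, and the norms of the
weights tend to infinity, their inverses being summable. *)

(** * Density and enumeration *)

Lemma dense_approx (K : numFieldType) (X : normedModType K) (S : set X) :
  (forall (x : X) (eps : K), 0 < eps -> exists2 y, S y & `|x - y| < eps) ->
  dense S.
Proof.
move=> approx O [x Ox] openO.
have /nbhs_ballP[eps /= eps0 ballO] : nbhs x O by exact: open_nbhs_nbhs.
have [y Sy xy] := approx x eps eps0.
by exists y; split => //; apply: ballO; rewrite -ball_normE.
Qed.

(** The number paired with x makes room for repetitions: the codes of the pairs
(a, x) are unbounded because they are distinct. *)
Lemma enumeration_with_repetition (T : countType) (x0 : T) :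
  exists f : nat -> T, forall x M, exists2 i, (M <= i)%N & f i = x.
Proof.
exists (fun i => (odflt (0, x0) (unpickle i : option (nat * T)%type)).2) => x M.
have [a aP] : exists a : nat, (M <= pickle (a, x))%N.
  apply/not_existsP => lt_M.
  have ltP (a : 'I_M.+1) : (pickle (a : nat, x) < M)%N.
    by rewrite ltnNge; apply/negP/lt_M.
  have /leq_card : injective (fun a => Ordinal (ltP a)).
    move=> a b /(congr1 val) /= /(pcan_inj pickleK) [ab].
    exact: val_inj.
  by rewrite !card_ord ltnn.
by exists (pickle (a, x)) => //; rewrite pickleK.
Qed.

(** * Block sequences *)

Section Shift.
Variables (K : numFieldType) (w : nat -> K).
Hypothesis w_mono : forall k, 1 <= `|w k| <= `|w k.+1|.

Definition wshift (c : nat -> K) : nat -> K := fun k => w k * c k.+1.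

Definition wprod (k n : nat) : K := \prod_(i < n) w (k + i)%N.

Lemma wprodD k m n : wprod k (m + n) = wprod k m * wprod (k + m) n.
Proof.
rewrite /wprod big_split_ord /=; congr (_ * _).
by apply: eq_bigr => i _; rewrite addnA.
Qed.

Lemma iter_wshift n c k : iter n wshift c k = wprod k n * c (k + n)%N.
Proof.
elim: n k => [|n IHn] k; first by rewrite /wprod big_ord0 mul1r addn0.
by rewrite iterS /wshift IHn mulrA -[n.+1]add1n wprodD /wprod big_ord1 addn0
  addn1 addnA addn1.
Qed.

Lemma w_homo : {homo (fun k => `|w k|) : i j / (i <= j)%N >-> i <= j}.
Proof.
apply: homo_leq => [x|y x z|k]; [exact: lexx|exact: le_trans|].
by have /andP[] := w_mono k.
Qed.

Lemma w_ge1 k : 1 <= `|w k|. Proof. by have /andP[] := w_mono k. Qed.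

Lemma w_norm_gt0 k : 0 < `|w k|.
Proof. exact: lt_le_trans ltr01 (w_ge1 k). Qed.

Lemma w_neq0 k : w k != 0. Proof. by rewrite -normr_gt0 w_norm_gt0. Qed.

Lemma wprod_neq0 k n : wprod k n != 0.
Proof. by apply/prodf_neq0 => i _; exact: w_neq0. Qed.

Lemma wprod_ge1 k n : 1 <= `|wprod k n|.
Proof.
rewrite normr_prod; apply: (big_ind (fun x => 1 <= x)) => [//|x y|i _].
  exact: mulr_ege1.
exact: w_ge1.
Qed.

(** The last two factors of the product already give the bound: the last one is
w (r + d).-1, and the one before it dominates w (N - 2) by monotonicity. *)
Lemma wprod_ge r N d : (1 < N)%N -> (N <= d)%N ->
  `|w (N - 2)| * `|w (r + d).-1| <= `|wprod r d|.
Proof.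
case: N => [|[|N]] // _; case: d => [|[|d]] // Nd.
rewrite -[X in wprod r X]addn2 wprodD normrM -[leLHS]mul1r.
apply: ler_pM; rewrite ?mulr_ge0 ?ler01 ?wprod_ge1 //.
rewrite /wprod big_ord_recl big_ord1 normrM /= addn0.
rewrite subSS subn1 /= !addnS /= addn0.
by apply: ler_wpM2r => //; apply: w_homo; rewrite (leq_trans _ (leq_addl _ _)).
Qed.

Section Blocks.
Variable n : nat -> nat.
Hypothesis n0 : n 0 = 0%N.
Hypothesis n_incr : forall j, (n j < n j.+1)%N.

Lemma n_homo : {homo n : i j / (i <= j)%N >-> (i <= j)%N}.
Proof.
by apply: homo_leq => [x|y x z|k]; [exact: leqnn|exact: leq_trans|exact: ltnW].
Qed.

Lemma block_cover m : exists j, (n j <= m < n j.+1)%N.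
Proof.
elim: m => [|m [j /andP[njm mnj]]].
  by exists 0%N; rewrite n0 leqnn -[X in (X < _)%N]n0 n_incr.
have [lt_m|ge_m] := ltnP m.+1 (n j.+1).
  by exists j; rewrite lt_m (leqW njm).
by exists j.+1; rewrite ge_m (leq_ltn_trans mnj).
Qed.

Lemma block_unique i j m :
  (n i <= m < n i.+1)%N -> (n j <= m < n j.+1)%N -> i = j.
Proof.
have le_block a b : (n a <= m)%N -> (m < n b.+1)%N -> (a <= b)%N.
  move=> am mb; rewrite leqNgt; apply/negP => /n_homo ba.
  by have := leq_trans mb (leq_trans ba am); rewrite ltnn.
move=> /andP[ni mi] /andP[nj mj].
by apply/eqP; rewrite eqn_leq (le_block _ _ ni mj) (le_block _ _ nj mi).
Qed.

(** Describing the sequence by its iterates at the times n j hides the quotients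
that define it and the choice of a block for each index. *)
Lemma block_sequence (s : nat -> nat -> K) : exists c : nat -> K,
  forall j k, (n j + k < n j.+1)%N -> iter (n j) wshift c k = s j k.
Proof.
have [b bP] := choice block_cover.
exists (fun m => s (b m) (m - n (b m))%N / wprod (m - n (b m)) (n (b m))).
move=> j k jk; rewrite iter_wshift [(k + _)%N]addnC.
have -> : b (n j + k)%N = j.
  by apply: block_unique (bP _) _; rewrite leq_addr.
by rewrite addKn mulrCA divff ?mulr1 // wprod_neq0.
Qed.

(** If k + m lies in block j.+1, at position r of it, the m-th iterate at k equals
s j.+1 r divided by the weights w r, ..., w k.-1. They number n j.+1 - m, at least
the gap n j.+1 - n j, so that [wprod_ge] leaves a factor w k.-1 once the bound on
s j.+1 has used up the other one. The bound does not
depend on m, which is why it gives the convergence of all iterates and the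
accuracy of those at the times n i. *)
Lemma block_tail (s : nat -> nat -> K) (c : nat -> K) i m k :
  (forall j k, (n j + k < n j.+1)%N -> iter (n j) wshift c k = s j k) ->
  (forall j, (1 < n j.+1 - n j)%N) ->
  (forall j k, `|s j.+1 k| <= `|w (n j.+1 - n j - 2)|) ->
  (m <= n i)%N -> (n i.+1 <= k + m)%N ->
  `|iter m wshift c k| <= `|w k.-1|^-1.
Proof.
move=> cP gap2 s_le mi ik.
have [j /andP[jk kj]] := block_cover (k + m).
have ij : (i < j)%N.
  rewrite ltnNge; apply/negP => /(@leq_ltn_trans _ _ i.+1) /(_ (ltnSn _)) /n_homo.
  by move=> ji; have := leq_trans kj (leq_trans ji ik); rewrite ltnn.
case: j jk kj ij => // j jk kj ij.
have mj : (m <= n j)%N := leq_trans mi (n_homo i j ij).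
set r := (k + m - n j.+1)%N; set d := (n j.+1 - m)%N.
have rd : (r + d)%N = k.
  by rewrite /r /d addnBA ?(leq_trans mj (ltnW _)) // subnK // addnK.
have sE : wprod r d * iter m wshift c k = s j.+1 r.
  rewrite -cP ?subnKC // !iter_wshift mulrA.
  have -> : (r + n j.+1)%N = (k + m)%N by rewrite subnK.
  congr (_ * _).
  by rewrite -{1}rd -wprodD /d subnK // (leq_trans mj (ltnW _)).
have := wprod_ge r _ _ (gap2 j) (leq_sub2l _ mj); rewrite rd => wle.
rewrite -div1r ler_pdivlMr ?w_norm_gt0 //.
rewrite -(ler_pM2l (w_norm_gt0 (n j.+1 - n j - 2))) mulr1.
apply: le_trans (s_le j r); rewrite -sE normrM mulrCA mulrC.
exact: ler_wpM2r.
Qed.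

End Blocks.
End Shift.

Arguments wshift {K} w c k.
Arguments wprod {K} w k n.

(** * Expansions in a Schauder basis *)

Section Expansions.
Variables (K : numFieldType) (X : normedModType K) (e : nat -> X).
Hypothesis e_basis : schauder_basis e.

Lemma expansion_inj c c' x : expansion e c x -> expansion e c' x -> c = c'.
Proof.
move=> cx c'x; have [_ /(_ x) [d [_ dU]]] := e_basis.
by rewrite -(dU c cx) -(dU c' c'x).
Qed.

Lemma expansion_lim_unique c x y : expansion e c x -> expansion e c y -> x = y.
Proof. exact/cvg_unique/norm_hausdorff. Qed.

Lemma basis_coordP x : expansion e (basis_coord e x) x.
Proof.
have [_ /(_ x) [c [cx _]]] := e_basis.
exact: (@getPex _ [set c | expansion e c x] (ex_intro _ c cx)).
Qed.

Lemma expansion_comb a c c' x y : expansion e c x -> expansion e c' y ->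
  expansion e (fun k => a * c k + c' k) (a *: x + y).
Proof.
move=> cx c'y; rewrite /expansion.
have -> : (fun k => (a * c k + c' k) *: e k) =
    a *: (fun k => c k *: e k) + (fun k => c' k *: e k).
  by apply/funext => k; rewrite scalerDl -scalerA.
by rewrite seriesD seriesZ; apply: cvgD => //; exact: cvgZl_tmp.
Qed.

Lemma expansion_finite c N : (forall k, (N <= k)%N -> c k = 0) ->
  expansion e c (\sum_(k < N) c k *: e k).
Proof.
move=> cN; apply: cvg_near_cst; near=> p.
have Np : (N <= p)%N by near: p; exact: nbhs_infty_ge.
rewrite -(subnK Np) series_addn [X in _ + X]big_nat_cond big1 ?addr0.
  by rewrite /series /= big_mkord.
by move=> k /andP[/andP[Nk _] _]; rewrite cN // scale0r.
Unshelve. all: by end_near. Qed.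

Lemma expansion0 : expansion e (fun=> 0) 0.
Proof. by have := expansion_finite (fun=> 0) 0; rewrite big_ord0; apply. Qed.

End Expansions.

(** * The weighted backward shift *)

Section BackwardShift.
Variables (K : numFieldType) (X : normedModType K).
Variables (e : nat -> X) (w : nat -> K).
Hypothesis e_basis : schauder_basis e.

Lemma backward_shift_expansion c x z :
  expansion e c x -> expansion e (wshift w c) z ->
  dom (backward_shift e w) x /\ act (backward_shift e w) x = z.
Proof.
move=> cx Tcz.
have cE : basis_coord e x = c.
  by apply: (expansion_inj _ _ _ e_basis _ _ x) => //; exact: basis_coordP.
rewrite /= /shift_series cE; split; first by apply/cvg_ex; exists z; exact: Tcz.
by apply: cvg_lim; [exact: norm_hausdorff|exact: Tcz].
Qed.

Lemma backward_shift_linear : linear_operator (backward_shift e w).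
Proof.
have coordP x : expansion e (basis_coord e x) x by exact: basis_coordP.
have actP x : dom (backward_shift e w) x ->
    expansion e (wshift w (basis_coord e x)) (act (backward_shift e w) x).
  by move=> domx; exact: domx.
split=> [|a x y domx domy].
  have [] // := backward_shift_expansion (fun=> 0) 0 0 (expansion0 _ _ e).
  rewrite (_ : wshift _ _ = fun=> 0); first exact: expansion0.
  by apply/funext => k; rewrite /wshift mulr0.
apply: (backward_shift_expansion
    (fun k => a * basis_coord e x k + basis_coord e y k)).
  exact: expansion_comb.
rewrite (_ : wshift _ _ = fun k => a * wshift w (basis_coord e x) k +
    wshift w (basis_coord e y) k); last first.
  by apply/funext => k; rewrite /wshift mulrDr mulrCA.
by apply: expansion_comb; exact: actP.
Qed.

(** Expansions of all the shifted coordinate sequences are what membership in the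
domains of all powers amounts to. *)
Lemma backward_shift_power c (z : nat -> X) :
  (forall m, expansion e (iter m (wshift w) c) (z m)) -> forall m,
  dom (power (backward_shift e w) m) (z 0) /\
  act (power (backward_shift e w) m) (z 0) = z m.
Proof.
move=> cz; elim=> [//|m [domm actm]].
have [domA actA] := backward_shift_expansion _ _ _ (cz m) (cz m.+1).
by rewrite /power iterS -/(power _ _) /= actm.
Qed.

Hypothesis e_norm : forall k, `|e k| = 1.
Hypothesis w_mono : forall k, 1 <= `|w k| <= `|w k.+1|.
Hypothesis w_summable : cvgn (series (fun k => `|w k|^-1)).

(** The weight at k.-1 is the one that [block_tail] leaves in the bound of the
coordinate at k. *)
Lemma w_tail (eps : K) : 0 < eps -> exists M, forall m p, (M <= m)%N ->
  \sum_(m <= k < p) `|w k.-1|^-1 < eps.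
Proof.
move: w_summable => /cvg_cauchy /cauchy_seriesP wcv eps0.
have [[P Q] /= [[M _ MP] [N _ NQ]] PQ] := wcv _ eps0.
exists (maxn M N).+1 => -[//|m] p; rewrite ltnS geq_max => /andP[Mm Nm].
rewrite big_add1 /=; move: p.-1 => {}p.
have [mp|/ltnW pm] := leqP m p; last by rewrite big_geq.
have /= := PQ (m, p) (conj (MP _ Mm) (NQ _ (leq_trans Nm mp))).
by rewrite ger0_norm ?sumr_ge0 // => k _; rewrite invr_ge0.
Qed.

Lemma w_unbounded (B : K) :
  0 <= B -> exists N, forall k, (N <= k)%N -> B <= `|w k|.
Proof.
move=> B0; have B1 : 0 < B + 1 by rewrite ltr_wpDl.
have [|N NP] := w_tail (B + 1)^-1; first by rewrite invr_gt0.
exists N => k Nk; have := NP k.+1 k.+2 (leqW Nk).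
rewrite big_nat1 /= ltf_pV2 ?posrE ?w_norm_gt0 // => /ltW.
by apply: le_trans; rewrite lerDl.
Qed.

Lemma backward_shift_unbounded : ~ bounded_operator (backward_shift e w).
Proof.
move=> [M AM].
have delta j : expansion e (fun k => (k == j)%:R) (e j).
  have := expansion_finite _ _ e (fun k => (k == j)%:R) j.+1.
  rewrite big_ord_recr /= eqxx scale1r big1 ?add0r.
    by apply=> k jk; rewrite gtn_eqF.
  by move=> i _; rewrite ltn_eqF // scale0r.
have wM k : `|w k| <= M.
  have [] := backward_shift_expansion _ _ (w k *: e k) (delta k.+1).
    have := expansion_comb _ _ e (w k) _ (fun=> 0) _ 0 (delta k).
    rewrite addr0 => /(_ (expansion0 _ _ e)).
    congr expansion; apply/funext => i; rewrite addr0 /wshift eqSS.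
    by have [->|_] := eqVneq i k; rewrite ?mulr0.
  by move=> /AM; move=> + AE; rewrite AE normrZ !e_norm !mulr1.
have M0 : 0 <= M by exact: le_trans (wM 0).
have [|N NP] := w_unbounded (M + 1); first by rewrite addr_ge0.
have := le_trans (NP N (leqnn _)) (wM N).
by rewrite gerDl ler10.
Qed.

End BackwardShift.

(** * Chaos *)

Section Chaos.
Variables (K : numFieldType) (X : completeNormedModType K).
Variables (e : nat -> X) (w : nat -> K).
Hypothesis e_basis : schauder_basis e.
Hypothesis e_norm : forall k, `|e k| = 1.
Hypothesis w_mono : forall k, 1 <= `|w k| <= `|w k.+1|.
Hypothesis w_summable : cvgn (series (fun k => `|w k|^-1)).

Definition fin_comb (s : seq K) : X := \sum_(k < size s) s`_k *: e k.

(** A gap N is long enough for s: it contains the support of s, so that s can be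
planted in a block of length N, and the weight at N - 2, which by monotonicity is
a lower bound for the next-to-last factor in a product of at least N weights,
dominates the entries, so that s can be planted after a gap N. *)
Definition fits (s : seq K) (N : nat) : Prop :=
  [/\ (1 < N)%N, (size s <= N)%N & forall k, `|s`_k| <= `|w (N - 2)|].

Lemma fits_eventually s : exists N0, forall N, (N0 <= N)%N -> fits s N.
Proof.
have [|N0 N0P] := w_unbounded _ _ w_mono w_summable (\sum_(k < size s) `|s`_k|).
  exact: sumr_ge0.
exists (maxn N0.+2 (size s)) => N; rewrite geq_max => /andP[N0N sN].
split=> // [|k]; first by apply: leq_trans N0N.
have [sk|ks] := leqP (size s) k; first by rewrite nth_default ?normr0.
apply: le_trans (N0P (N - 2)%N _); last by rewrite leq_subRL ?(leq_trans _ N0N).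
by rewrite (bigD1 (Ordinal ks)) //= lerDl sumr_ge0.
Qed.

Lemma norm_sum_le_tail c m p :
  (forall k, (m <= k)%N -> `|c k| <= `|w k.-1|^-1) ->
  `|\sum_(m <= k < p) c k *: e k| <= \sum_(m <= k < p) `|w k.-1|^-1.
Proof.
move=> cw; apply: le_trans (ler_norm_sum _ _ _) _.
rewrite big_nat_cond [leRHS]big_nat_cond.
apply: ler_sum => k /andP[/andP[mk _] _].
by rewrite normrZ e_norm mulr1 cw.
Qed.

Lemma tail_expansion c N :
  (forall k, (N <= k)%N -> `|c k| <= `|w k.-1|^-1) -> exists x, expansion e c x.
Proof.
move=> cw; apply/cvg_ex/cauchy_cvgP/cauchy_seriesP => eps eps0.
have [M MP] := w_tail _ _ w_summable _ eps0.
exists ([set m | (maxn M N <= m)%N], setT) => /=.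
  by split; [exact: nbhs_infty_ge|exact: filterT].
move=> [m p] /= [+ _]; rewrite geq_max => /andP[Mm Nm].
apply: le_lt_trans (MP m p Mm); apply: norm_sum_le_tail => k mk.
exact/cw/(leq_trans Nm).
Qed.

Lemma expansion_tail_le c x m eps : expansion e c x ->
  (forall k, (m <= k)%N -> `|c k| <= `|w k.-1|^-1) ->
  (forall p, \sum_(m <= k < p) `|w k.-1|^-1 <= eps) ->
  `|x - \sum_(k < m) c k *: e k| <= eps.
Proof.
move=> cx cw weps; apply/ler_addgt0Pl => d d0.
have [p [mp xp]] : exists p, (m <= p)%N /\
    `|x - series (fun k => c k *: e k) p| <= d.
  near (@nbhs _ (set_system nat) \oo) => p; exists p; split.
    by near: p; exact: nbhs_infty_ge.
  by near: p; move: d d0; apply/cvgrPdist_le.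
rewrite -[x in `|x - _|](subrK (series (fun k => c k *: e k) p)) -addrA.
apply: le_trans (ler_normD _ _) _; apply: lerD => //.
rewrite -[\sum_(k < m) _](big_mkord xpredT (fun k => c k *: e k)).
rewrite -[\sum_(0 <= k < m) _]/(series (fun k => c k *: e k) m) sub_series_geq //.
exact: le_trans (norm_sum_le_tail _ _ _ cw) (weps p).
Unshelve. all: by end_near. Qed.

Section Orbit.
Variables (n : nat -> nat) (s : nat -> seq K).
Hypothesis n0 : n 0 = 0%N.
Hypothesis fit_cur : forall j, fits (s j) (n j.+1 - n j).
Hypothesis fit_next : forall j, fits (s j.+1) (n j.+1 - n j).

(** Each sequence fits the gap of its own block, for the accuracy of the iterate
that shows it, and the preceding gap, for its smallness at earlier times. *)
Lemma block_orbit : exists (c : nat -> K) (z : nat -> X),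
  [/\ forall j k, (n j + k < n j.+1)%N -> iter (n j) (wshift w) c k = (s j)`_k,
      forall m, expansion e (iter m (wshift w) c) (z m) &
      forall i eps,
        (forall p, \sum_(n i.+1 - n i <= k < p) `|w k.-1|^-1 <= eps) ->
        `|z (n i) - fin_comb (s i)| <= eps].
Proof.
have gap j : (1 < n j.+1 - n j)%N by have [] := fit_cur j.
have n_incr j : (n j < n j.+1)%N by rewrite -subn_gt0 ltnW.
have s_le j k : `|(s j.+1)`_k| <= `|w (n j.+1 - n j - 2)|.
  by have [] := fit_next j.
have n_ge m : (m <= n m)%N.
  by elim: m => // m IHm; exact: leq_ltn_trans IHm (n_incr m).
have [c cP] := block_sequence _ _ w_mono _ n0 n_incr (fun j => nth 0 (s j)).
have tail i m k := block_tail _ _ w_mono _ n0 n_incr _ _ i m k cP gap s_le.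
have expand m : exists x, expansion e (iter m (wshift w) c) x.
  (* As m <= n m, the m-th iterate is controlled from the index n m.+1 on. *)
  apply: (tail_expansion _ (n m.+1)) => k mk.
  by apply: (tail m) => //; exact: leq_trans mk (leq_addr _ _).
have [z zP] := choice expand.
exists c, z; split=> // i eps weps.
rewrite (_ : fin_comb _ =
    \sum_(k < n i.+1 - n i) iter (n i) (wshift w) c k *: e k); last first.
  have [_ size_s _] := fit_cur i.
  rewrite /fin_comb (big_ord_widen _ (fun k => (s i)`_k *: e k) size_s).
  rewrite big_mkcond; apply: eq_bigr => k _.
  rewrite cP -?ltn_subRL //.
  by case: ltnP => // sk; rewrite nth_default // scale0r.
apply: expansion_tail_le weps => // k ik; apply: (tail i) => //.
by rewrite addnC -leq_subLR.
Qed.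

End Orbit.

Section Dense.
Variable D : nat -> K.
Hypothesis D_dense : forall (x eps : K), 0 < eps -> exists a, `|x - D a| < eps.

(** Truncate the expansion, then move its coefficients into the dense set one at a
time, halving the allowed error at each step. *)
Lemma fin_comb_dense (x : X) (eps : K) : 0 < eps ->
  exists t : seq nat, `|x - fin_comb [seq D a | a <- t]| < eps.
Proof.
have partial p (c : nat -> K) d : 0 < d -> exists2 t : seq nat, size t = p &
    `|\sum_(k < p) c k *: e k - fin_comb [seq D a | a <- t]| < d.
  elim: p d => [|p IHp] d d0.
    by exists [::]; rewrite // /fin_comb !big_ord0 subrr normr0.
  have d2 : 0 < d / 2 by rewrite divr_gt0.
  have [t size_t tP] := IHp _ d2; have [a aP] := D_dense (c p) _ d2.
  exists (rcons t a); first by rewrite size_rcons size_t.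
  rewrite /fin_comb size_map size_rcons size_t !big_ord_recr /=.
  rewrite map_rcons nth_rcons size_map size_t ltnn eqxx.
  rewrite opprD addrACA -scalerBl [d]splitr.
  apply: le_lt_trans (ler_normD _ _) _.
  rewrite ltrD // ?normrZ ?e_norm ?mulr1 //.
  move: tP; rewrite /fin_comb size_map size_t; congr (`|_ - _| < _).
  by apply: eq_bigr => k _; rewrite nth_rcons size_map size_t ltn_ord.
move=> eps0; have eps2 : 0 < eps / 2 by rewrite divr_gt0.
have /cvgrPdist_lt/(_ _ eps2) [p _ /(_ p (leqnn p)) xp] :=
  basis_coordP _ _ _ e_basis x.
have [t _ tP] := partial p (basis_coord e x) _ eps2.
exists t; rewrite [eps]splitr.
rewrite -[x](subrK (series (fun k => basis_coord e x k *: e k) p)) -addrA.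
apply: le_lt_trans (ler_normD _ _) _; apply: ltrD => //.
by rewrite /series /= big_mkord.
Qed.

Lemma periodic_dense : dense [set x | periodic_point (backward_shift e w) x].
Proof.
apply: dense_approx => x eps eps0.
have eps2 : 0 < eps / 2 by rewrite divr_gt0.
have [t tP] := fin_comb_dense x _ eps2; set s := [seq D a | a <- t] in tP.
have [N0 N0P] := fits_eventually s.
have [M MP] := w_tail _ _ w_summable _ eps2.
pose N := maxn N0 M.
have fitN : fits s N by apply: N0P; exact: leq_maxl.
have N_gt0 : (0 < N)%N by case: fitN => /ltnW.
have gapE j : (j.+1 * N - j * N)%N = N by rewrite mulSn addnK.
have [//|||c [z [cP zP zs]]] := block_orbit (fun j => j * N)%N (fun=> s).
- by move=> j; rewrite gapE.
- by move=> j; rewrite gapE.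
have cN : iter N (wshift w) c = c.
  (* At m = j * N + k, both sides times wprod k (j * N) are the iterates of orders
     j.+1 * N and j * N at k, which show the same sequence. *)
  apply/funext => m; rewrite (divn_eq m N).
  set j := (m %/ N)%N; set k := (m %% N)%N.
  have kN : (k < N)%N by rewrite ltn_mod.
  apply: (mulfI (wprod_neq0 _ _ w_mono k (j * N))).
  rewrite addnC -!iter_wshift -iterD addnC -mulSn !cP //.
    by rewrite mulSn addnC ltn_add2r.
  by rewrite mulSn addnC ltn_add2r.
have [domN actN] := backward_shift_power _ _ _ _ e_basis c z zP N.
exists (z 0).
  exists N; split=> //; rewrite actN.
  apply: (expansion_lim_unique _ _ e c); last exact: (zP 0).
  by have := zP N; rewrite cN.
rewrite [eps]splitr -[x](subrK (fin_comb s)) -addrA.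
apply: le_lt_trans (ler_normD _ _) _; apply: ltr_leD => //.
rewrite distrC; apply: (zs 0%N) => p; rewrite gapE; apply/ltW/MP.
exact: leq_maxr.
Qed.

Lemma backward_shift_hypercyclic : hypercyclic (backward_shift e w).
Proof.
have [f f_rep] := enumeration_with_repetition (seq nat) [::].
pose s j := [seq D a | a <- f j].
have [N0 N0P] := choice (fun j => fits_eventually (s j)).
(* The lower bound j makes the errors tend to 0 along the orbit. *)
pose d j := maxn (maxn (N0 j) (N0 j.+1)) j.
pose n j := (\sum_(i < j) d i)%N.
have gapE j : (n j.+1 - n j)%N = d j by rewrite /n big_ord_recr /= addKn.
have [|||c [z [_ zP zs]]] := block_orbit n s.
- by rewrite /n big_ord0.
- by move=> j; rewrite gapE; apply: N0P; rewrite /d !leq_max leqnn.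
- by move=> j; rewrite gapE; apply: N0P; rewrite /d !leq_max leqnn orbT.
have z_approx x eps : 0 < eps -> exists m, `|x - z m| < eps.
  move=> eps0; have eps2 : 0 < eps / 2 by rewrite divr_gt0.
  have [t tP] := fin_comb_dense x _ eps2.
  have [M MP] := w_tail _ _ w_summable _ eps2.
  have [i Mi fi] := f_rep t M.
  exists (n i); rewrite [eps]splitr -[x](subrK (fin_comb (s i))) -addrA.
  apply: le_lt_trans (ler_normD _ _) _; apply: ltr_leD; first by rewrite /s fi.
  rewrite distrC; apply: zs => p; rewrite gapE; apply/ltW/MP.
  by rewrite (leq_trans Mi) // /d leq_max leqnn orbT.
have zpow := backward_shift_power _ _ _ _ e_basis c z zP.
exists (z 0); split.
  (* A zero initial vector has zero iterates, which stay away from e 0. *)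
- apply/eqP => z0.
  have c0 : c = fun=> 0.
    apply: (expansion_inj _ _ _ e_basis _ _ (z 0)); first exact: (zP 0).
    by rewrite z0; exact: expansion0.
  have [m] := z_approx (e 0) 1 ltr01; rewrite (_ : z m = 0).
    by rewrite subr0 e_norm ltxx.
  apply: (expansion_lim_unique _ _ e (fun=> 0)); last exact: expansion0.
  have := zP m; rewrite (_ : iter _ _ _ = fun=> 0) //.
  by apply/funext => k; rewrite iter_wshift c0 mulr0.
- by move=> m _; have [] := zpow m.
- apply: dense_approx => x eps /(z_approx x) [m xm].
  by exists (z m) => //; exists m => //; have [] := zpow m.
Qed.

End Dense.
End Chaos.

(** * The scalar fields and the theorem *)

Lemma scalar_field_separable (R : realType) (s : scalar_kind) :
  exists D : nat -> scalar_field R s,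
    forall (x eps : scalar_field R s), 0 < eps -> exists a, `|x - D a| < eps.
Proof.
have real_approx (x eps : R) : 0 < eps -> exists q : rat, `|x - ratr q| < eps.
  move=> eps0; have [|q] := @rat_in_itvoo R (x - eps) (x + eps).
    by rewrite ltrD2l gtrN.
  by rewrite in_itv /= => qx; exists q; rewrite distrC ltr_distl.
case: s => /=.
  exists (fun a => ratr (odflt 0 (unpickle a : option rat))) => x eps.
  by move=> /(real_approx x) [q xq]; exists (pickle q); rewrite pickleK.
exists (fun a => let q := odflt (0, 0) (unpickle a : option (rat * rat)%type) in
  (ratr q.1 +i* ratr q.2)%C).
move=> [x y] [d d'] /=; rewrite ltcE /= => /andP[/eqP -> d0].
have d2 : 0 < d / 2 by rewrite divr_gt0.
have [p xp] := real_approx x _ d2; have [q yq] := real_approx y _ d2.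
exists (pickle (p, q)); rewrite pickleK /=.
rewrite normc_def ltcE /= eqxx /= -[d in ltRHS]gtr0_norm // -sqrtr_sqr.
rewrite ltr_sqrt ?exprn_gt0 // -[(x - _) ^+ 2]real_normK ?num_real //
  -[(y - _) ^+ 2]real_normK ?num_real //.
have half_sqr (a : R) : 0 <= a -> a < d / 2 -> a ^+ 2 < d ^+ 2 / 2.
  move=> a0 ad; apply: (@lt_le_trans _ _ ((d / 2) ^+ 2)).
    by rewrite ltr_pXn2r // nnegrE ltW.
  by rewrite exprMn ler_wpM2l ?exprn_ge0 ?ltW // expr2 gtr_pMl ?invf_lt1 ?ltr1n.
by rewrite [ltRHS]splitr ltrD // half_sqr.
Qed.

Theorem theorem4p1 (R : realType) (s : scalar_kind)
    (X : completeNormedModType (scalar_field R s))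
    (e : nat -> X) (w : nat -> scalar_field R s)
    (e_basis : schauder_basis e)
    (e_norm : forall k, `|e k| = 1)
    (w_mono : forall k, 1 <= `|w k| <= `|w k.+1|)
    (w_summable : cvgn (series (fun k => `|w k|^-1))) :
  [/\ linear_operator (backward_shift e w),
      ~ bounded_operator (backward_shift e w) &
      chaotic (backward_shift e w)].
Proof.
have [D D_dense] := scalar_field_separable R s.
split; first exact: backward_shift_linear.
  exact: backward_shift_unbounded.
split; first exact: backward_shift_hypercyclic D_dense.
exact: periodic_dense D_dense.
Qed.
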